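(* Let $M$ be a $po$-$\Gamma$-semigroup. The ideals of $M$ are prime if and only if they form a chain (under inclusion) and $M$ is intra-regular.
   Context: A $po$-$\Gamma$-semigroup is a nonempty set $M$ with a nonempty set $\Gamma$ of binary operations on $M$, satisfying $(a\gamma b)\mu c=a\gamma(b\mu c)$ for all $a,b,c\in M$ and $\gamma,\mu\in\Gamma$, and a partial order $\le$ on $M$ such that $a\le b$ implies $a\gamma c\le b\gamma c$ and $c\gamma a\le c\gamma b$ for all $c\in M$, $\gamma\in\Gamma$. For $A,B\subseteq M$, $A\Gamma B=\{a\gamma b\mid a\in A,\ b\in B,\ \gamma\in\Gamma\}$ (and similarly for longer products, with singletons written as elements; e.g. $M\Gamma x\gamma x\Gamma M=\{a\delta x\gamma x\xi b\mid a,b\in M,\ \delta,\xi\in\Gamma\}$ for fixed $\gamma$). For $H\subseteq M$, $(H]=\{t\in M\mid t\le a \text{ for some } a\in H\}$. $M$ is intra-regular if $x\in(M\Gamma x\gamma x\Gamma M]$ for every $x\in M$ and every $\gamma\in\Gamma$. An ideal of $M$ is a nonempty subset $A$ with $M\Gamma A\subseteq A$, $A\Gamma M\subseteq A$, and such that $a\in A$, $b\in M$, $b\le a$ imply $b\in A$. A subset $T$ of $M$ is prime if $a,b\in M$, $\gamma\in\Gamma$, $a\gamma b\in T$ imply $a\in T$ or $b\in T$. *)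

(* Defs.v *)
From mathcomp Require Import all_boot all_order.
From mathcomp Require Import mathcomp_extra boolp classical_sets.

Set Implicit Arguments.
Unset Strict Implicit.
Unset Printing Implicit Defensive.

Local Open Scope classical_set_scope.
Local Open Scope order_scope.

Section Defs.
Context {d : Order.disp_t} {M : porderType d}.
Implicit Types (Gam : set (M -> M -> M)) (A B T : set M).

Record po_gamma_semigroup Gam : Prop := PoGammaSemigroup {
  pgs_carrier_nonempty : [set: M] !=set0;
  pgs_ops_nonempty : Gam !=set0;
  pgs_assoc : forall g m, Gam g -> Gam m ->
    forall a b c, m (g a b) c = g a (m b c);
  pgs_le_mulr : forall g, Gam g ->
    forall a b c, a <= b -> g a c <= g b c;
  pgs_le_mull : forall g, Gam g ->
    forall a b c, a <= b -> g c a <= g c b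
}.

Definition gprod Gam A B : set M :=
  \bigcup_(g in Gam) [set g a b | a in A & b in B].

(* The set M Gam x g x Gam M is bracketed as M Gam (x g x) Gam M; by
   associativity the bracketing is immaterial in a po-Gamma-semigroup.
   [down H] is the downward closure (H]. *)
Definition intra_regular Gam : Prop :=
  forall (x : M) g, Gam g ->
    down (gprod Gam (gprod Gam [set: M] [set g x x]) [set: M]) x.

Record ideal Gam A : Prop := Ideal {
  ideal_nonempty : A !=set0;
  ideal_mull : gprod Gam [set: M] A `<=` A;
  ideal_mulr : gprod Gam A [set: M] `<=` A;
  ideal_down : forall a b, A a -> b <= a -> A b
}.

Definition prime_subset Gam T : Prop :=
  forall a b g, Gam g -> T (g a b) -> T a \/ T b.

End Defs.

(* Main.v *)
Require Import Defs.
From mathcomp Require Import all_boot all_order.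
From mathcomp Require Import mathcomp_extra boolp classical_sets.

Local Open Scope classical_set_scope.

(** If all ideals are prime, two incomparable ideals [A] and [B] would give
    [a] in [A] outside [B] and [b] in [B] outside [A]; but the product of [a]
    and [b] lies in the ideal [A `&` B], so primality puts one of them in both.
    Intra-regularity comes from the ideal [J y] of elements below a product
    with [y] strictly in the middle: with [y = x g x], the square [y g y] is
    [x g y g x], hence in [J y]; using primality twice, first [y] and then [x]
    is in [J y], which is intra-regularity at [x] and [g].

    Conversely, intra-regularity says that every ideal [T] is semiprime (it
    contains [x] as soon as it contains a square of [x]), and that [x] belongs
    to [J x]. By semiprimality, once [T] contains a product, it also contains the
    product of the same factors in the other order or by another operation, and
    the products with a further factor inserted between them
    ([semiprime_prodC], [semiprime_prod_insert]).
    Since ideals form a chain, [J a] and [J b] are comparable, so one of the two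
    elements, say [a], lies below a product [m b n]. Then the square [a g a] is
    below [(a m b) n], which is in [T] when [a g b] is, and [a] is in [T] by
    semiprimality. *)

Section Ideals.
Context {d : Order.disp_t} {M : porderType d} {Gam : set (M -> M -> M)}.
Hypothesis hM : po_gamma_semigroup Gam.
Implicit Types (A B T : set M) (a b x y : M) (g h k : M -> M -> M).

Lemma ideal_opl {A} : ideal Gam A -> forall g x a, Gam g -> A a -> A (g x a).
Proof.
by move=> hA g x a hg ha; apply: (ideal_mull hA); exists g => //;
  exists x => //; exists a.
Qed.

Lemma ideal_opr {A} : ideal Gam A -> forall g a x, Gam g -> A a -> A (g a x).
Proof.
by move=> hA g a x hg ha; apply: (ideal_mulr hA); exists g => //;
  exists a => //; exists x.
Qed.

Lemma ideal_setI {A B} : ideal Gam A -> ideal Gam B -> ideal Gam (A `&` B).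
Proof.
move=> hA hB; split.
- have [a Aa] := ideal_nonempty hA; have [b Bb] := ideal_nonempty hB.
  have [g hg] := pgs_ops_nonempty hM.
  by exists (g a b); split; [exact: (ideal_opr hA)|exact: (ideal_opl hB)].
- by move=> _ [g hg [x _ [a [Aa Ba] <-]]];
  split; [exact: (ideal_opl hA)|exact: (ideal_opl hB)].
- by move=> _ [g hg [a [Aa Ba] [x _ <-]]];
  split; [exact: (ideal_opr hA)|exact: (ideal_opr hB)].
- by move=> a b [Aa Ba] ba; split; [exact: (ideal_down hA Aa)|exact: (ideal_down hB Ba)].
Qed.

(** The intra-regularity condition at [x] and [g] is [J (g x x) x]. In general
    [J y] need not contain [y]. *)
Definition J y : set M :=
  down (gprod Gam (gprod Gam [set: M] [set y]) [set: M]).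

Lemma JP y t :
  J y t <-> exists h k m n, [/\ Gam h, Gam k & (t <= k (h m y) n)%O].
Proof.
split.
  by move=> [_ [[k hk [_ [h hh [m _ [_ -> <-]]] [n _ <-]]] le]]; exists h, k, m, n.
move=> [h [k [m [n [hh hk le]]]]]; exists (k (h m y) n); split=> //.
by exists k => //; exists (h m y); [exists h => //; exists m => //; exists y|exists n].
Qed.

Lemma ideal_J y : ideal Gam (J y).
Proof.
split.
- have [g hg] := pgs_ops_nonempty hM.
  by exists (g (g y y) y); apply/JP; exists g, g, y, y.
- move=> _ [g hg [x _ [t /JP[h [k [m [n [hh hk le]]]]] <-]]].
  apply/JP; exists h, k, (g x m), n; split=> //.
  rewrite (pgs_assoc hM hg hh) (pgs_assoc hM hg hk).
  exact: (pgs_le_mull hM hg).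
- move=> _ [g hg [t /JP[h [k [m [n [hh hk le]]]]] [x _ <-]]].
  apply/JP; exists h, k, m, (g n x); split=> //.
  rewrite -(pgs_assoc hM hk hg).
  exact: (pgs_le_mulr hM hg).
- move=> a b /JP[h [k [m [n [hh hk le]]]]] ba.
  by apply/JP; exists h, k, m, n; split=> //; exact: Order.POrderTheory.le_trans ba le.
Qed.

Section Prime.
Hypothesis primeM : forall A, ideal Gam A -> prime_subset Gam A.

Lemma prime_ideals_chain :
  total_on [set A : set M | ideal Gam A] (fun A B : set M => A `<=` B).
Proof.
move=> A B /= hA hB; have [AB|/existsNP[a /not_implyP[Aa nBa]]] := pselect (A `<=` B).
  by left.
right=> b Bb; have [g hg] := pgs_ops_nonempty hM.
have ABab : (A `&` B) (g a b) by split; [exact: (ideal_opr hA)|exact: (ideal_opl hB)].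
by have [[]|[]] := primeM _ (ideal_setI hA hB) _ _ _ hg ABab.
Qed.

Lemma prime_ideals_intra_regular : intra_regular Gam.
Proof.
move=> x g hg; rewrite -/(J (g x x)).
have prJ := primeM _ (ideal_J (g x x)).
have Jyy : J (g x x) (g (g x x) (g x x)).
  by apply/JP; exists g, g, x, x; rewrite !(pgs_assoc hM hg hg).
have Jy : J (g x x) (g x x) by case: (prJ _ _ _ hg Jyy).
by case: (prJ _ _ _ hg Jy).
Qed.

End Prime.

Section IntraRegular.
Hypothesis irM : intra_regular Gam.

Lemma intra_regular_J x : J x x.
Proof.
have [g hg] := pgs_ops_nonempty hM.
have /JP[h [k [m [n [hh hk le]]]]] := irM x g hg.
(* [m h (x g x) k n] is [(m h x) g x k n], with [x] in the middle. *)
by apply/JP; exists g, k, (h m x), n; rewrite (pgs_assoc hM hh hg).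
Qed.

Context {T : set M}.
Hypothesis hT : ideal Gam T.

Lemma intra_regular_semiprime {g x} : Gam g -> T (g x x) -> T x.
Proof.
move=> hg Txx; have /JP[h [k [m [n [hh hk le]]]]] := irM x g hg.
by apply: (ideal_down hT _ le); apply: (ideal_opr hT) => //; exact: (ideal_opl hT).
Qed.

(** The square of [b h a] is [b h (a g b) h a]. *)
Lemma semiprime_prodC {g h a b} : Gam g -> Gam h -> T (g a b) -> T (h b a).
Proof.
move=> hg hh Tab; apply: (intra_regular_semiprime hg).
rewrite (pgs_assoc hM hh hg) -(pgs_assoc hM hg hh).
by apply: (ideal_opl hT) => //; exact: (ideal_opr hT).
Qed.

(** The square of [(a h m) k b] has [b g a] in its middle. *)
Lemma semiprime_prod_insert {g h k a b} m : Gam g -> Gam h -> Gam k ->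
  T (g a b) -> T (k (h a m) b).
Proof.
move=> hg hh hk Tab; apply: (intra_regular_semiprime hg).
rewrite (pgs_assoc hM hk hg); apply: (ideal_opl hT) => //.
rewrite -(pgs_assoc hM hg hk) -(pgs_assoc hM hg hh).
by do 2!apply: (ideal_opr hT) => //; exact: (semiprime_prodC hg hg Tab).
Qed.

Lemma semiprime_prod_J {g a b} : Gam g -> T (g a b) -> J b a -> T a.
Proof.
move=> hg Tab /JP[h [k [m [n [hh hk le]]]]].
apply: (intra_regular_semiprime hg).
apply: (ideal_down hT _ (pgs_le_mull hM hg a le)).
rewrite -(pgs_assoc hM hg hk) -(pgs_assoc hM hg hh).
by apply: (ideal_opr hT) => //; exact: (semiprime_prod_insert m hg hg hh Tab).
Qed.

Lemma chain_intra_regular_prime :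
  total_on [set A : set M | ideal Gam A] (fun A B : set M => A `<=` B) ->
  prime_subset Gam T.
Proof.
move=> chain a b g hg Tab.
have [JaJb|JbJa] := chain _ _ (ideal_J a) (ideal_J b).
- by left; apply: (semiprime_prod_J hg Tab); exact/JaJb/intra_regular_J.
- right; apply: (semiprime_prod_J hg (semiprime_prodC hg hg Tab)).
  exact/JbJa/intra_regular_J.
Qed.

End IntraRegular.
End Ideals.

Theorem theorem13 (d : Order.disp_t) (M : porderType d)
    (Gam : set (M -> M -> M)) (hM : po_gamma_semigroup Gam) :
  (forall A : set M, ideal Gam A -> prime_subset Gam A) <->
  (total_on [set A : set M | ideal Gam A] (fun A B : set M => A `<=` B) /\
   intra_regular Gam).
Proof.
split=> [primeM|[chain irM] T hT].
- by split; [exact: prime_ideals_chain|exact: prime_ideals_intra_regular].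
- exact: chain_intra_regular_prime.
Qed.
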